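(* Let $\mathbb{K}$ be an algebraically closed field, let $A$ be a $\mathbb{K}$-algebra which is a domain, let $\alpha$ be a $\mathbb{K}$-automorphism of $A$, let $u\in Z(A)\setminus\mathbb{K}$ and let $R=R(A,\alpha,u-\alpha(u),1)$ be the corresponding conformal ambiskew polynomial ring, with Casimir element $z=xy-u$. Suppose that $A[y^{\pm 1};\alpha]$ is simple and $Z(A[y^{\pm 1};\alpha])=\mathbb{K}$. Let $\lambda\in\mathbb{K}$ be such that the ideal $(z-\lambda)R$ is not maximal and $(u+\lambda)A+\alpha^m(u+\lambda)A\neq A$ for some $m\geq 1$. If the factor $A/\bigl((u+\lambda)A+\alpha^m(u+\lambda)A\bigr)$ is a simple right Ore domain and $(u+\lambda)A+\alpha^n(u+\lambda)A=A$ for all positive integers $n\neq m$, then $R/(z-\lambda)R$ has a unique non-zero prime ideal $P/(z-\lambda)R$ and $R/P$ has right Goldie rank $m$.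
   Context: Rings are associative with $1$; $Z(\cdot)$ denotes the centre. For a $\mathbb{K}$-algebra $A$, a $\mathbb{K}$-automorphism $\alpha$ of $A$ and a central element $v\in A$, the ambiskew polynomial algebra $R(A,\alpha,v,1)$ is the iterated skew polynomial ring $A[y;\alpha][x;\beta,\delta]$, where $\beta=\alpha^{-1}$ on $A$, $\beta(y)=y$, and $\delta$ is the $\beta$-derivation of $A[y;\alpha]$ with $\delta(A)=0$ and $\delta(y)=v$. Thus $ya=\alpha(a)y$ and $xa=\alpha^{-1}(a)x$ for all $a\in A$, and $xy=yx+v$. When $v=u-\alpha(u)$ with $u$ central in $A$, the ring is called conformal and the Casimir element $z=xy-u$ is central in $R$. The ring $A[y^{\pm 1};\alpha]$ is the skew Laurent polynomial ring with $ya=\alpha(a)y$. The right Goldie rank of a ring is the uniform (Goldie) dimension of the ring as a right module over itself. *)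

(* Defs.v *)
From HB Require Import structures.
From mathcomp Require Import all_boot all_order all_algebra finmap.
From mathcomp Require Import boolp classical_sets.

Set Implicit Arguments.
Unset Strict Implicit.
Unset Printing Implicit Defensive.

Import GRing.Theory.
Local Open Scope ring_scope.
Local Open Scope classical_set_scope.
Local Open Scope quotient_scope.

(* The zero ring is allowed as a factor ring, hence pzRingType; the predicates
   that exclude it say so explicitly. *)

Definition center (R : pzRingType) : set R :=
  [set c | forall r : R, c * r = r * c].
Arguments center R : clear implicits.

Definition is_domain (R : pzRingType) : Prop :=
  (1 : R) <> 0 /\ forall a b : R, a * b = 0 -> a = 0 \/ b = 0.

Definition is_ideal (R : pzRingType) (I : set R) : Prop :=
  [/\ I 0,
      forall a b, I a -> I b -> I (a + b) &
      forall r a, I a -> I (r * a) /\ I (a * r)].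

(* two-sided *)
Record ideal (R : pzRingType) :=
  Ideal { ideal_set :> set R; idealP : is_ideal ideal_set }.

Definition principal_right (R : pzRingType) (c : R) : set R :=
  [set c * r | r in [set: R]].

Definition set_sum (R : pzRingType) (X Y : set R) : set R :=
  [set a | exists2 b, X b & exists2 c, Y c & a = b + c].

Definition simple_ring (R : pzRingType) : Prop :=
  (1 : R) <> 0 /\
  forall I : set R, is_ideal I -> I = [set 0] \/ I = [set: R].

Definition maximal_ideal (R : pzRingType) (I : set R) : Prop :=
  [/\ is_ideal I, I <> [set: R] &
      forall J : set R, is_ideal J -> I `<=` J -> J = I \/ J = [set: R]].

Definition prime_ideal (R : pzRingType) (P : set R) : Prop :=
  [/\ is_ideal P, P <> [set: R] &
      forall I J : set R, is_ideal I -> is_ideal J ->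
        (forall a b, I a -> J b -> P (a * b)) -> I `<=` P \/ J `<=` P].

(* Factor rings: the library's additive quotient, with the ring structure that
   the library only provides when R is commutative. *)

Section FactorRing.
Variables (R : pzRingType) (I : ideal R).

Definition ideal_pred : {pred R} := fun a => `[< (I : set R) a >].

Lemma ideal_pred_zmod_closed : zmod_closed ideal_pred.
Proof.
have [I0 ID IM] := idealP I.
split=> [|a b /asboolP Ia /asboolP Ib]; apply/asboolP=> //.
by apply: ID => //; rewrite -mulN1r; case: (IM (- 1) b Ib).
Qed.

HB.instance Definition _ :=
  GRing.isZmodClosed.Build R ideal_pred ideal_pred_zmod_closed.

Definition factor_ring : Type := Quotient.quot (ideal_pred : zmodClosed R).

HB.instance Definition _ := GRing.Zmodule.on factor_ring.
HB.instance Definition _ :=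
  EqQuotient.copy factor_ring (Quotient.quot (ideal_pred : zmodClosed R)).

Definition factor_map (a : R) : factor_ring := \pi_factor_ring a.

Lemma factor_mapP a b : factor_map a = factor_map b <-> (I : set R) (a - b).
Proof.
by split=> [/eqP|h]; [|apply/eqP]; rewrite /factor_map -Quotient.idealrBE;
  [move/asboolP|apply/asboolP].
Qed.

Lemma factor_map_surj (q : factor_ring) : exists a, q = factor_map a.
Proof. by exists (repr q); rewrite /factor_map reprK. Qed.

Lemma factor_mapB : {morph factor_map : a b / a - b}.
Proof.
by move=> a b; rewrite /factor_map Quotient.pi_add Quotient.pi_opp.
Qed.

Definition factor_one : factor_ring := factor_map 1.

Definition factor_mul (p q : factor_ring) : factor_ring :=
  factor_map (repr p * repr q).

Lemma factor_repr a : (I : set R) (repr (factor_map a) - a).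
Proof. by apply/factor_mapP; rewrite /factor_map reprK. Qed.

Lemma factor_mapM :
  {morph factor_map : a b / a * b >-> factor_mul a b}.
Proof.
move=> a b; apply/esym/factor_mapP; have [I0 ID IM] := idealP I.
set a' := repr _; set b' := repr _.
have -> : a' * b' - a * b = (a' - a) * b' + a * (b' - b).
  by rewrite mulrBl mulrBr addrA subrK.
by apply: ID;
  [case: (IM b' (a' - a) (factor_repr a))|case: (IM a (b' - b) (factor_repr b))].
Qed.

Lemma factor_mapD : {morph factor_map : a b / a + b}.
Proof. by move=> a b; rewrite /factor_map Quotient.pi_add. Qed.

Lemma factor_mulA : associative factor_mul.
Proof.
move=> p q r; have [a ->] := factor_map_surj p.
have [b ->] := factor_map_surj q; have [c ->] := factor_map_surj r.
by rewrite -!factor_mapM mulrA.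
Qed.

Lemma factor_mul1 : left_id factor_one factor_mul.
Proof.
by move=> p; have [a ->] := factor_map_surj p; rewrite -factor_mapM mul1r.
Qed.

Lemma factor_1mul : right_id factor_one factor_mul.
Proof.
by move=> p; have [a ->] := factor_map_surj p; rewrite -factor_mapM mulr1.
Qed.

Lemma factor_mulDl : left_distributive factor_mul +%R.
Proof.
move=> p q r; have [a ->] := factor_map_surj p.
have [b ->] := factor_map_surj q; have [c ->] := factor_map_surj r.
by rewrite -factor_mapD -!factor_mapM -factor_mapD mulrDl.
Qed.

Lemma factor_mulDr : right_distributive factor_mul +%R.
Proof.
move=> p q r; have [a ->] := factor_map_surj p.
have [b ->] := factor_map_surj q; have [c ->] := factor_map_surj r.
by rewrite -factor_mapD -!factor_mapM -factor_mapD mulrDr.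
Qed.

HB.instance Definition _ := GRing.Zmodule_isPzRing.Build factor_ring
  factor_mulA factor_mul1 factor_1mul factor_mulDl factor_mulDr.

HB.instance Definition _ :=
  GRing.isZmodMorphism.Build R factor_ring factor_map factor_mapB.

Lemma factor_map_monoid_morphism : monoid_morphism factor_map.
Proof. by split=> [|a b]; rewrite ?factor_mapM. Qed.

HB.instance Definition _ :=
  GRing.isMonoidMorphism.Build R factor_ring factor_map
    factor_map_monoid_morphism.

End FactorRing.

Definition right_ore_domain (R : pzRingType) : Prop :=
  is_domain R /\
  forall a s : R, s <> 0 -> exists b t : R, t <> 0 /\ a * t = s * b.

(* Right ideals are the submodules of R as a right module over itself. *)
Definition right_ideal (R : pzRingType) (V : set R) : Prop :=
  [/\ V 0, forall a b, V a -> V b -> V (a + b) & forall a r, V a -> V (a * r)].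

Definition nonzero_right_ideal (R : pzRingType) (V : set R) : Prop :=
  right_ideal V /\ V <> [set 0].

Definition uniform_right_ideal (R : pzRingType) (U : set R) : Prop :=
  nonzero_right_ideal U /\
  forall V W : set R, nonzero_right_ideal V -> nonzero_right_ideal W ->
    V `<=` U -> W `<=` U -> V `&` W <> [set 0].

Definition essential_right_ideal (R : pzRingType) (E : set R) : Prop :=
  right_ideal E /\
  forall V : set R, nonzero_right_ideal V -> V `&` E <> [set 0].

(* The uniform dimension of R as a right R-module is n when R_R has an essential
   submodule that is a direct sum of n uniform submodules. *)
Definition right_goldie_rank (R : pzRingType) (n : nat) : Prop :=
  exists U : 'I_n -> set R,
    [/\ forall i, uniform_right_ideal (U i),
        forall a : 'I_n -> R, (forall i, U i (a i)) ->
          \sum_(i < n) a i = 0 -> forall i, a i = 0 &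
        essential_right_ideal
          [set b | exists2 a : 'I_n -> R,
                     forall i, U i (a i) & b = \sum_(i < n) a i]].

(* Skew polynomial rings. An extension ring of S is given by a morphism
   iota : S -> T; it is a skew polynomial (or skew Laurent) extension in t when
   it satisfies the commutation rule and is free as a left S-module on the
   powers of t. This determines T up to isomorphism over S, and forces iota to
   be injective. *)

Definition free_left_basis (S T : pzRingType) (iota : S -> T)
    (J : choiceType) (b : J -> T) : Prop :=
  forall t : T, exists! c : {fsfun J -> S with 0},
    t = \sum_(j <- finsupp c) iota (c j) * b j.

(* This side of the Leibniz rule matches t s = sigma(s) t + delta(s). *)
Definition skew_derivation (S : pzRingType) (sigma delta : S -> S) : Prop :=
  {morph delta : a b / a + b} /\
  forall a b, delta (a * b) = sigma a * delta b + delta a * b.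

(* T = S[t; sigma, delta] *)
Definition is_skew_polynomial (S T : pzRingType) (sigma : {rmorphism S -> S})
    (delta : S -> S) (iota : {rmorphism S -> T}) (t : T) : Prop :=
  [/\ skew_derivation sigma delta,
      forall s, t * iota s = iota (sigma s) * t + iota (delta s) &
      free_left_basis iota (fun n : nat => t ^+ n)].

(* L = A[y^{+-1}; alpha] *)
Definition is_skew_laurent (A : pzRingType) (L : unitRingType)
    (alpha : {rmorphism A -> A}) (iota : {rmorphism A -> L}) (y : L) : Prop :=
  [/\ y \is a GRing.unit,
      forall a, y * iota a = iota (alpha a) * y &
      free_left_basis iota (fun k : int => y ^ k)].

(* R = R(A, alpha, v, 1), as the iterated extension A -> T -> R with
   T = A[y; alpha] and R = T[x; beta, delta]. *)
Definition is_ambiskew (A T R : pzRingType) (alpha : {rmorphism A -> A}) (v : A)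
    (inT : {rmorphism A -> T}) (y : T) (inR : {rmorphism T -> R}) (x : R) :
    Prop :=
  is_skew_polynomial alpha (fun=> 0) inT y /\
  exists (beta : {rmorphism T -> T}) (delta : T -> T),
    [/\ forall a, beta (inT (alpha a)) = inT a,
        beta y = y,
        forall a, delta (inT a) = 0,
        delta y = inT v &
        is_skew_polynomial beta delta inR x].

(* Main.v *)
(* Put f = u + lambda. Modulo z - lambda the ring R becomes the generalized Weyl
   algebra S with x y = f and y x = alpha f. Inverting y turns S into the simple
   ring A[y^{+-1}; alpha], and inverting x does the same, so every non-zero
   ideal Q of S contains powers of x and of y. If k is least with x^k in Q, then
   x^(k-1) is killed modulo Q by f and by alpha^k f; by comaximality k = m when
   Q is proper, and likewise for y.

   Let W be the intersection of the non-zero ideals of S and P the annihilator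
   of the left module S p, where p is the image of x^(m-1) in S/W. The element
   y^(m-1) x^(m-1) of A is a unit modulo J, which yields t in Ay^(m-1) with
   p t p = p modulo P; then e = t p is idempotent and the elements
   x^i t x^(m-1-i) (i < m) are orthogonal idempotents with sum 1, with corner
   e (R/P) e = A/J. Hence R/P is simple of Goldie rank m. A non-zero
   prime Q contains W but not x^(m-1), so it contains P, which is maximal. *)
Require Import Defs.
From HB Require Import structures.
From mathcomp Require Import all_boot all_order all_algebra finmap.
From mathcomp Require Import boolp classical_sets.

Set Implicit Arguments.
Unset Strict Implicit.
Unset Printing Implicit Defensive.

Import GRing.Theory.
Local Open Scope ring_scope.
Local Open Scope classical_set_scope.

(** * Ideals, factor maps and comaximality over a simple factor *)

Lemma ideal0 (R : pzRingType) (I : ideal R) : (I : set R) 0.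
Proof. by have [] := idealP I. Qed.

Lemma idealD (R : pzRingType) (I : ideal R) a b :
  (I : set R) a -> (I : set R) b -> (I : set R) (a + b).
Proof. by have [_ + _] := idealP I; apply. Qed.

Lemma idealMl (R : pzRingType) (I : ideal R) r a :
  (I : set R) a -> (I : set R) (r * a).
Proof. by have [_ _ IM] := idealP I => /(IM r)[]. Qed.

Lemma idealMr (R : pzRingType) (I : ideal R) a r :
  (I : set R) a -> (I : set R) (a * r).
Proof. by have [_ _ IM] := idealP I => /(IM r)[]. Qed.

Lemma idealN (R : pzRingType) (I : ideal R) a :
  (I : set R) a -> (I : set R) (- a).
Proof. by rewrite -mulN1r; apply: idealMl. Qed.

Lemma ideal_proper (R : pzRingType) (I : ideal R) :
  (I : set R) <> [set: R] <-> ~ (I : set R) 1.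
Proof.
split=> [In I1|In IT]; last by apply: In; rewrite IT.
by apply: In; apply/seteqP; split=> // r _; rewrite -(mul1r r); apply: idealMr.
Qed.

Lemma factor_map0 (R : pzRingType) (I : ideal R) (a : R) :
  factor_map I a = 0 <-> (I : set R) a.
Proof.
by rewrite -(rmorph0 (factor_map I)); rewrite factor_mapP subr0.
Qed.

Lemma preimage_is_ideal (R S : pzRingType) (h : {rmorphism R -> S})
  (I : set S) : is_ideal I -> is_ideal (h @^-1` I).
Proof.
move=> [I0 ID IM]; split=> [|a b|r a]; rewrite /preimage /=.
- by rewrite rmorph0.
- by rewrite rmorphD; apply: ID.
- by rewrite !rmorphM; apply: IM.
Qed.

Lemma image_is_ideal (R S : pzRingType) (h : {rmorphism R -> S})
  (I : set R) : (forall s, exists r, s = h r) -> is_ideal I ->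
  is_ideal (h @` I).
Proof.
move=> surj [I0 ID IM]; split=> [|_ _ [a Ia <-] [b Ib <-]|s _ [a Ia <-]].
- by exists 0; rewrite ?rmorph0.
- by exists (a + b); rewrite ?rmorphD //; apply: ID.
have [r ->] := surj s; have [Ira Iar] := IM r a Ia.
by split; [exists (r * a) | exists (a * r)]; rewrite ?rmorphM.
Qed.

(** The image of [H] in the simple ring [R/I] is a non-zero ideal, hence everything; [H] need not
    contain [I]. *)
Lemma simple_factor_comaximal (R : pzRingType) (I : ideal R) (H : set R) a :
  simple_ring (factor_ring I) -> is_ideal H -> H a -> ~ (I : set R) a ->
  exists h i, [/\ H h, (I : set R) i & 1 = h + i].
Proof.
move=> [_ simpl] idH Ha nIa.
have [HI|HI] := simpl _ (image_is_ideal (@factor_map_surj _ I) idH).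
  have : [set 0] (factor_map I a) by rewrite -HI; exists a.
  by rewrite /= factor_map0.
have : [set: factor_ring I] (factor_map I 1) by [].
rewrite -HI => -[h Hh /esym/factor_mapP Ih].
by exists h, (1 - h); split=> //; rewrite addrC subrK.
Qed.

Lemma ore_factor (R : pzRingType) (I : ideal R) :
  right_ore_domain (factor_ring I) ->
  forall a s, ~ (I : set R) s ->
  exists b t, ~ (I : set R) t /\ (I : set R) (a * t - s * b).
Proof.
move=> [_ ore] a s Is.
have [|b [t [t0]]] := ore (factor_map I a) (factor_map I s).
  by rewrite factor_map0.
have [b' ->] := factor_map_surj b.
have [t' tE] := factor_map_surj t; move: t0; rewrite tE factor_map0 => It.
by rewrite -!rmorphM => /factor_mapP ?; exists b', t'.
Qed.

Lemma domain_factor (R : pzRingType) (I : ideal R) :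
  right_ore_domain (factor_ring I) ->
  forall a b, (I : set R) (a * b) -> (I : set R) a \/ (I : set R) b.
Proof.
move=> [[_ dom] _] a b /factor_map0; rewrite rmorphM => /dom.
by rewrite !factor_map0.
Qed.

(* [x], [y] satisfy the relations of the generalized Weyl algebra
   [A(alpha, f)], the factor of the conformal ambiskew ring by [z - lambda]
   for [f = u + lambda]. *)
Record gwa_rel (A C : pzRingType) (alpha : A -> A) (f : A) (phi : A -> C)
    (x y : C) : Prop := GwaRel {
  gwa_yA : forall a, y * phi a = phi (alpha a) * y;
  gwa_xA : forall a, x * phi (alpha a) = phi a * x;
  gwa_xy : x * y = phi f;
  gwa_yx : y * x = phi (alpha f) }.

Definition comaximal_shift (A : pzRingType) (alpha : A -> A) (f : A) n : Prop :=
  exists a b, f * a + iter n alpha f * b = 1.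

(** * Generalized Weyl relations and the nilpotency index of [x] and [y] *)

Section GwaFactor.
Variables (A C : pzRingType) (phi : {rmorphism A -> C}).
Variables (alpha : {rmorphism A -> A}) (f : A) (x y : C).
Hypothesis alpha_surj : forall a, exists b, a = alpha b.
Hypothesis f_central : center A f.
Hypothesis rel : gwa_rel alpha f phi x y.

Let yA := gwa_yA rel.
Let xA := gwa_xA rel.
Let xy := gwa_xy rel.
Let yx := gwa_yx rel.

Lemma gwa_yXA k a : y ^+ k * phi a = phi (iter k alpha a) * y ^+ k.
Proof.
elim: k => [|k IH]; first by rewrite mul1r mulr1.
by rewrite exprS -mulrA IH mulrA yA -!mulrA -exprS.
Qed.

Lemma gwa_xXA k a : x ^+ k * phi (iter k alpha a) = phi a * x ^+ k.
Proof.
elim: k => [|k IH]; first by rewrite mul1r mulr1.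
by rewrite exprSr -mulrA iterS xA !mulrA IH.
Qed.

Lemma iter_central k : center A (iter k alpha f).
Proof.
elim: k => // k IH a; have [b ->] := alpha_surj a.
by rewrite iterS -!rmorphM IH.
Qed.

(** One has [x^(k-1) f = x^k y], and moving [alpha^k f] to the left gives [x^(k-1) alpha^k(f) =
    alpha(f) x^(k-1) = y x^k]. *)
Lemma gwa_x_pow k : x ^+ k = 0 ->
  x ^+ k.-1 * phi f = 0 /\ x ^+ k.-1 * phi (iter k alpha f) = 0.
Proof.
case: k => [|k /= xk0].
  (* For [k = 0] the hypothesis reads [1 = 0], so everything vanishes. *)
  by rewrite expr0 => C0; split; rewrite -[LHS]mul1r ?C0 ?mul0r.
split; first by rewrite -xy mulrA -exprSr xk0 mul0r.
by rewrite -iterS iterSr gwa_xXA -yx -mulrA -exprS xk0 mulr0.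
Qed.

Lemma gwa_y_pow k : y ^+ k = 0 ->
  phi f * y ^+ k.-1 = 0 /\ phi (iter k alpha f) * y ^+ k.-1 = 0.
Proof.
case: k => [|k /= yk0].
  by rewrite expr0 => C0; split; rewrite -[LHS]mul1r ?C0 ?mul0r.
split; first by rewrite -xy -mulrA -exprS yk0 mulr0.
by rewrite -iterS iterSr -gwa_yXA -yx mulrA -exprSr yk0 mul0r.
Qed.

(* Lowers the nilpotency index: [x^(k-1)] is killed by [f] and by
   [alpha^k f]. *)
Lemma gwa_x_index m : (1 : C) <> 0 ->
  (forall k, (0 < k)%N -> k <> m -> comaximal_shift alpha f k) ->
  (exists k, x ^+ k = 0) -> x ^+ m = 0 /\ x ^+ m.-1 <> 0.
Proof.
move=> C1 cmx ex.
have exb : exists k, x ^+ k == 0 by case: ex => k /eqP; exists k.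
case: (ex_minnP exb) => k /eqP xk0 kmin.
have k0 : (0 < k)%N by case: k xk0 {kmin} => // /C1.
have xk1 : x ^+ k.-1 <> 0.
  by move/eqP/kmin; rewrite leqNgt ltn_predL k0.
have [<-//|/eqP km] := eqVneq k m.
have [a [b ab1]] := cmx k k0 km; have [xf xfk] := gwa_x_pow xk0.
case: xk1; rewrite -[LHS]mulr1 -(rmorph1 phi) -ab1 rmorphD !rmorphM.
by rewrite mulrDr !mulrA xf xfk !mul0r addr0.
Qed.

(** Mirror of [gwa_x_index]: here [f] and [alpha^k f] kill [y^(k-1)] from the left, and their
    centrality brings them next to it. *)
Lemma gwa_y_index m : (1 : C) <> 0 ->
  (forall k, (0 < k)%N -> k <> m -> comaximal_shift alpha f k) ->
  (exists k, y ^+ k = 0) -> y ^+ m = 0.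
Proof.
move=> C1 cmx ex.
have exb : exists k, y ^+ k == 0 by case: ex => k /eqP; exists k.
case: (ex_minnP exb) => k /eqP yk0 kmin.
have k0 : (0 < k)%N by case: k yk0 {kmin} => // /C1.
have yk1 : y ^+ k.-1 <> 0.
  by move/eqP/kmin; rewrite leqNgt ltn_predL k0.
have [<-//|/eqP km] := eqVneq k m.
have [a [b ab1]] := cmx k k0 km; have [yf yfk] := gwa_y_pow yk0.
case: yk1; rewrite -[LHS]mul1r -(rmorph1 phi) -ab1.
rewrite f_central (iter_central k) rmorphD !rmorphM.
by rewrite mulrDl -!mulrA yf yfk !mulr0 addr0.
Qed.

(** * The element [y^n x^n] of [A] modulo [J], where [n + 1] stands for [m] *)

Variable n : nat.
Hypothesis cmx : forall k, (0 < k)%N -> k <> n.+1 -> comaximal_shift alpha f k.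
Variable J : ideal A.
Hypothesis JE : J = set_sum (principal_right f)
                    (principal_right (iter n.+1 alpha f)) :> set A.
Hypothesis xn0 : x ^+ n.+1 = 0.
Hypothesis yn0 : y ^+ n.+1 = 0.

Lemma gwa_xJ j : (J : set A) j -> x ^+ n * phi j = 0.
Proof.
rewrite JE => -[_ [b _ <-] [_ [c _ <-] ->]].
have [xf xfn] := gwa_x_pow xn0.
by rewrite rmorphD !rmorphM mulrDr !mulrA xf xfn !mul0r addr0.
Qed.

Lemma gwa_Jy j : (J : set A) j -> phi j * y ^+ n = 0.
Proof.
rewrite JE => -[_ [b _ <-] [_ [c _ <-] ->]].
have [yf yfn] := gwa_y_pow yn0.
rewrite f_central (iter_central n.+1) rmorphD !rmorphM mulrDl -!mulrA.
by rewrite yf yfn !mulr0 addr0.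
Qed.

(** [y^k x^k] is the product of the [alpha^i f] for [1 <= i <= k]. As [i <= n], comaximality makes
    each factor invertible modulo [f], hence also the product. *)
Lemma gwa_yx_pow k : (k <= n)%N ->
  exists F d a, [/\ center A F, y ^+ k * x ^+ k = phi F & F * d = 1 + f * a].
Proof.
elim: k => [_|k IH kn].
  exists 1, 1, 0; split; first by move=> a; rewrite mul1r mulr1.
    by rewrite mulr1 rmorph1.
  by rewrite mulr0 addr0 mulr1.
have [F [d [a [Fc FE Fd]]]] := IH (ltnW kn).
have [|b [c bc]] := cmx (ltn0Sn k); first by case=> E; rewrite E ltnn in kn.
set g := iter k.+1 alpha f in bc; have gc : center A g := iter_central k.+1.
(* Here [c] inverts [g] modulo [f]; the last witness collects the multiples of [f] in
   [(1 + f a)(1 - f b)]. *)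
exists (g * F), (d * c), (a - b - a * (f * b)); split.
- by move=> r; rewrite -mulrA Fc mulrA gc mulrA.
- rewrite exprSr exprS mulrA -(mulrA _ y) yx gwa_yXA -iterSr.
  by rewrite -mulrA FE rmorphM.
- have -> : g * F * (d * c) = (F * d) * (g * c).
    by rewrite gc -!mulrA; congr (F * _); rewrite !mulrA gc.
  have -> : g * c = 1 - f * b by rewrite -bc addrC addKr.
  rewrite Fd mulrBr mulr1 mulrDl mul1r !mulrBr !mulrA -!addrA; congr (_ + _).
  by rewrite opprD addrA.
Qed.


(** With [F = y^n x^n] and [F d = 1 + f a], take [t = d y^n] and [ep = d F]. Then [ep] is 1 modulo
    [J], and the identities come from [x^n J = J y^n = 0]; centrality of [F] gives
    [j d F = y^n x^n j d = 0] for [j] in [J]. *)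
Lemma gwa_matrix_data : exists t ep,
  [/\ [/\ y * t = 0, t * x ^+ n = phi ep, x ^+ n * phi ep = x ^+ n &
          phi ep * t = t],
      forall j, (J : set A) j -> phi j * phi ep = 0,
      forall a, phi ep * phi a * phi ep = phi a * phi ep &
      forall s, (s < n)%N -> exists c, t * x ^+ s = c * y].
Proof.
have [F [d [a [Fc FE Fd]]]] := gwa_yx_pow (leqnn n).
have Jf b : (J : set A) (f * b).
  rewrite JE; exists (f * b); first by exists b.
  exists 0; last by rewrite addr0.
  by exists 0; rewrite ?mulr0.
have dF : d * F = 1 + f * a by rewrite -Fc.
have JdF j : (J : set A) j -> phi j * phi (d * F) = 0.
  move=> Jj; rewrite -rmorphM mulrA -Fc rmorphM -FE -mulrA gwa_xJ ?mulr0 //.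
  exact: idealMr.
exists (phi d * y ^+ n), (d * F); split=> //.
- split.
  + by rewrite mulrA yA -mulrA -exprS yn0 mulr0.
  + by rewrite -mulrA FE rmorphM.
  + by rewrite dF rmorphD rmorph1 mulrDr mulr1 gwa_xJ ?addr0.
  + rewrite mulrA -rmorphM dF mulrDl mul1r rmorphD mulrDl.
    by rewrite (gwa_Jy (idealMr _ (Jf a))) addr0.
- move=> b; rewrite -rmorphM {1}dF mulrDl mul1r rmorphD mulrDl.
  by rewrite (JdF _ (idealMr _ (Jf a))) addr0.
move=> s sn; have [Fs [_ [_ [_ FsE _]]]] := gwa_yx_pow (ltnW sn).
(* As [s < n], splitting off [y^s x^s = Fs] leaves a spare [y], which is carried to the right of
   [Fs]. *)
exists (phi d * (y ^+ (n - s.+1) * phi (alpha Fs))).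
rewrite -!mulrA -yA -FsE; congr (_ * _).
by rewrite !mulrA -exprSr -exprD -subSn // subSS subnK // ltnW.
Qed.

(** * The corner at [e] and a complete family of orthogonal idempotents *)

Hypothesis gen : forall M : set C, M 0 -> (forall c d, M c -> M d ->
  M (c + d)) ->
  (forall a c, M c -> M (phi a * c)) -> (forall c, M c -> M (x * c)) ->
  (forall c, M c -> M (y * c)) -> forall c v, M v -> M (c * v).
Hypothesis xn_neq0 : x ^+ n <> 0.
(** [C x^n] is faithful as a left module; factoring out an annihilator secures this. *)
Hypothesis faithful : forall c, (forall s, c * s * x ^+ n = 0) -> c = 0.
Hypothesis AJ_simple : simple_ring (factor_ring J).
Hypothesis AJ_ore : right_ore_domain (factor_ring J).

Variables (t : C) (ep : A).
Local Notation e := (phi ep).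
Hypothesis yt : y * t = 0.
Hypothesis txn : t * x ^+ n = e.
Hypothesis xne : x ^+ n * e = x ^+ n.
Hypothesis et : e * t = t.
Hypothesis Je : forall j, (J : set A) j -> phi j * e = 0.
Hypothesis eAe : forall a, e * phi a * e = phi a * e.
Hypothesis tx_lt : forall s, (s < n)%N -> exists c, t * x ^+ s = c * y.

Let xn_ge s : (n < s)%N -> x ^+ s = 0.
Proof. by move=> ns; rewrite -(subnK ns) exprD xn0 mulr0. Qed.

Let ye : y * e = 0. Proof. by rewrite -txn mulrA yt mul0r. Qed.

(** For [s < n] the element [t x^s] ends in [y], which kills [phi a e]; for [s > n] already
    [x^s = 0]. Thus [t x^(n-i)] reads off the coefficient of [x^i] on [C e]. *)
Lemma gwa_tx s a : t * x ^+ s * (phi a * e) = if s == n then phi a * e else 0.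
Proof.
case: ltngtP => [/tx_lt[c ->]|/xn_ge ->|->].
- by rewrite -mulrA (mulrA y) yA -mulrA ye !mulr0.
- by rewrite mulr0 mul0r.
- by rewrite txn mulrA eAe.
Qed.

Lemma gwa_tx_e s : t * x ^+ s * e = if s == n then e else 0.
Proof. by have := gwa_tx s 1; rewrite rmorph1 mul1r. Qed.

(** The span of the elements [x^k phi a e] contains [e] and is stable under [x] because
    [x^(n+1) = 0], and under [y] because [y e = 0] and [y x = alpha f]. *)
Lemma gwa_Ce_ind (N : set C) : N 0 -> (forall c d, N c -> N d -> N (c + d)) ->
  (forall k a, (k <= n)%N -> N (x ^+ k * (phi a * e))) -> forall c, N (c * e).
Proof.
(* [M] is the additive span, taken as the intersection of all admissible [N]. A single [N] need not
   be stable under left multiplication; for [M] stability follows by passing to a translate of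
   [N]. *)
move=> N0 ND NX c; pose M v := forall N : set C, N 0 ->
  (forall c d, N c -> N d -> N (c + d)) ->
  (forall k a, (k <= n)%N -> N (x ^+ k * (phi a * e))) -> N v.
suff: M (c * e) by apply.
apply: (@gen M) => [||a||| {}N {}N0 {}ND {}NX].
- by move=> ? ? ?.
- by move=> c1 c2 M1 M2 N' N0' ND' NX';
  exact: ND' (M1 N' N0' ND' NX') (M2 N' N0' ND' NX').
- move=> v Mv N' N0' ND' NX'; apply: (Mv (fun w => N' (phi a * w))).
  + by rewrite mulr0.
  + by move=> c1 c2 ? ?; rewrite mulrDr; apply: ND'.
  + by move=> k b kn; rewrite mulrA -gwa_xXA -mulrA (mulrA (phi _)) -rmorphM;
    apply: NX'.
- move=> v Mv N' N0' ND' NX'; apply: (Mv (fun w => N' (x * w))).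
  + by rewrite mulr0.
  + by move=> c1 c2 ? ?; rewrite mulrDr; apply: ND'.
  + move=> k b kn; rewrite mulrA -exprS.
    have [kn1|kn1] := leqP k.+1 n; first exact: NX'.
    by rewrite xn_ge // mul0r.
- move=> v Mv N' N0' ND' NX'; apply: (Mv (fun w => N' (y * w))).
  + by rewrite mulr0.
  + by move=> c1 c2 ? ?; rewrite mulrDr; apply: ND'.
  + move=> [|k] b kn; first by rewrite expr0 mul1r mulrA yA -mulrA ye mulr0.
    rewrite exprS !mulrA yx -gwa_xXA -!mulrA (mulrA (phi _)) -rmorphM.
    by apply: NX'; apply: ltnW.
by have := NX 0 1 (leq0n n); rewrite rmorph1 expr0 !mul1r.
Qed.

(** With the left [e] written as [t x^n], the term [t x^(n+k) phi a e] vanishes unless [k = 0]. *)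
Lemma gwa_corner c : exists a, e * c * e = phi a * e.
Proof.
rewrite -mulrA; move: c; apply: (gwa_Ce_ind (N := fun v =>
  exists a, e * v = phi a * e)).
- by exists 0; rewrite rmorph0 mul0r mulr0.
- by move=> c d [a aE] [b bE]; exists (a + b);
  rewrite mulrDr aE bE rmorphD mulrDl.
move=> k a _; rewrite -{1}txn mulrA -(mulrA t) -exprD gwa_tx.
by case: ifP => _; [exists a | exists 0; rewrite rmorph0 mul0r].
Qed.

(** The annihilator of [e] in [A] is two-sided because [phi r e = e phi r e]. An element outside [J]
    would make it comaximal with [J], which kills [e] too, so that [e = 0] and [x^n = x^n e = 0]. *)
Lemma gwa_corner_eq0 a : phi a * e = 0 -> (J : set A) a.
Proof.
move=> ae0; apply: contrapT => nJa.
pose H := [set b | phi b * e = 0] : set A.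
have idH : is_ideal H.
  split; rewrite /H /=; first by rewrite rmorph0 mul0r.
    by move=> b c b0 c0; rewrite rmorphD mulrDl b0 c0 addr0.
  move=> r b b0; rewrite !rmorphM -!mulrA b0 mulr0; split=> //.
  by rewrite -eAe !mulrA b0 !mul0r.
have [h [j [Hh Jj hj1]]] := simple_factor_comaximal AJ_simple idH ae0 nJa.
apply: xn_neq0; rewrite -xne -[e]mul1r -(rmorph1 phi) hj1 rmorphD mulrDl.
by rewrite Hh Je // addr0 mulr0.
Qed.

(** Diagonal matrix units: on [C e], [E i] is the projection onto [x^i phi A e]. *)
Let E i := x ^+ i * (t * x ^+ (n - i)).

(** Inserting [e] before the second [t] isolates the factor [t x^(n-i+k) e], which [gwa_tx_e]
    evaluates. *)
Lemma gwa_idem_orth i k : (i <= n)%N -> (k <= n)%N ->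
  E i * E k = if i == k then E i else 0.
Proof.
move=> lin lkn.
have -> : E i * E k = x ^+ i * (t * x ^+ (n - i + k) * e) * (t * x ^+ (n - k)).
  by rewrite /E exprD -!mulrA (mulrA e) et.
rewrite gwa_tx_e.
have -> : (n - i + k == n)%N = (i == k).
  by apply/eqP/eqP => [|<-]; [move/(congr1 (addn i));
    rewrite addnA subnKC // addnC => /addIn | rewrite subnK].
by case: eqP => [<-|_]; [rewrite -mulrA (mulrA e) et | rewrite mulr0 mul0r].
Qed.

(** By faithfulness it suffices to test on [C x^n], which lies in [C e]; on [x^k phi a e] only [E k]
    contributes. *)
Lemma gwa_idem_sum : \sum_(i < n.+1) E i = 1.
Proof.
apply/subr0_eq/faithful => s; rewrite -mulrA -xne (mulrA s).
move: (s * _); apply: (gwa_Ce_ind (N := fun v => (_ - 1) * v = 0)).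
- by rewrite mulr0.
- by move=> c d cE dE; rewrite mulrDr cE dE addr0.
move=> k a kn; apply/eqP; rewrite mulrBl mul1r subr_eq0 mulr_suml; apply/eqP.
have kn1 : (k < n.+1)%N by [].
rewrite (bigD1 (Ordinal kn1)) //= big1 ?addr0 => [|i ik].
  by rewrite /E -!mulrA (mulrA _ (x ^+ k)) -exprD subnK // (mulrA t) gwa_tx
    eqxx.
rewrite /E -!mulrA (mulrA _ (x ^+ k)) -exprD (mulrA t) gwa_tx.
have lin : (i <= n)%N by rewrite -ltnS.
case: eqP => [|_]; last by rewrite mulr0.
move/(congr1 (addn i)); rewrite addnA subnKC // addnC => /addIn kiE.
by case/eqP: ik; apply: val_inj.
Qed.

Lemma gwa_idem_retract i a : (i <= n)%N ->
  t * x ^+ (n - i) * (x ^+ i * (phi a * e)) = phi a * e.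
Proof. by move=> lin; rewrite mulrA -(mulrA t) -exprD subnK // gwa_tx eqxx. Qed.

Lemma gwa_idem_neq0 i a : (i <= n)%N -> ~ (J : set A) a ->
  x ^+ i * (phi a * e) <> 0.
Proof.
move=> lin nJa xa0; apply/nJa/gwa_corner_eq0.
by rewrite -(gwa_idem_retract a lin) xa0 mulr0.
Qed.

(** [v] is the sum of the [v E j = (v x^j e) t x^(n-j)]. *)
Lemma gwa_right_split v : v <> 0 -> exists j, (j <= n)%N /\ v * x ^+ j * e <> 0.
Proof.
move=> v0; apply: contrapT => nex; apply: v0.
rewrite -[v]mulr1 -gwa_idem_sum mulr_sumr big1 // => i _.
rewrite /E mulrA -et -(mulrA e) mulrA.
have [->|/eqP vi] := eqVneq (v * x ^+ i * e) 0; first by rewrite mul0r.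
by case: nex; exists i; split=> //; rewrite -ltnS.
Qed.

(** Since [v = x^i e t x^(n-i) v], what follows [x^i] in [v x^j e] lies in the corner. *)
Lemma gwa_idem_corner i v : (i <= n)%N -> E i * v = v ->
  forall j, exists a, v * x ^+ j * e = x ^+ i * (phi a * e).
Proof.
move=> lin vE j; rewrite -{1}vE /E -et.
have [a aE] := gwa_corner (t * x ^+ (n - i) * v * x ^+ j).
by exists a; rewrite -aE !mulrA.
Qed.

(** A non-zero [v] in [V] is cut by some [E i] on the left and some [x^j e] on the right down to
    [x^i phi a e] with [a] outside [J]. Hence [phi a e] is in [V], simplicity of [A/J] gives [e],
    and every [E i] factors through [e]. *)
Lemma gwa_factor_simple : simple_ring C.
Proof.
split=> [C1|V idV]; first by apply: xn_neq0; rewrite -[LHS]mul1r C1 mul0r.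
have [V0 VD VM] := idV.
have [[v [Vv v0]]|nV] := pselect (exists v, V v /\ v <> 0); last first.
  left; apply/seteqP; split=> [v Vv /=|_ ->] //.
  by apply: contrapT => v0; apply: nV; exists v.
right; apply/seteqP; split=> // r _.
suff Ve : V e.
  have V1 : V 1.
    rewrite -gwa_idem_sum; apply: (big_ind V) => // i _.
    by rewrite /E -et -mulrA mulrA; apply: (VM _ _ _).2; apply: (VM _ _ _).1.
  by rewrite -[r]mulr1; apply: (VM _ _ V1).1.
have [i [lin Ev]] : exists i, (i <= n)%N /\ E i * v <> 0.
  apply: contrapT => nex; apply: v0.
  rewrite -[v]mul1r -gwa_idem_sum mulr_suml big1 // => i _.
  have [//|/eqP vi] := eqVneq (E i * v) 0.
  by case: nex; exists i; split=> //; rewrite -ltnS.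
have [j [_ vj]] := gwa_right_split Ev.
have [|a aE] := gwa_idem_corner (v := E i * v) lin _ j.
  by rewrite mulrA gwa_idem_orth // eqxx.
have nJa : ~ (J : set A) a by move=> /Je a0; apply: vj; rewrite aE a0 mulr0.
have Va : V (phi a * e).
  rewrite -(gwa_idem_retract a lin) -aE.
  apply: (VM _ _ _).1; do 2!apply: (VM _ _ _).2.
  exact: (VM _ _ Vv).1.
pose H := [set b | V (phi b * e)] : set A.
have idH : is_ideal H.
  split; rewrite /H /=; first by rewrite rmorph0 mul0r.
    by move=> b c b0 c0; rewrite rmorphD mulrDl; apply: VD.
  move=> s b Vb; rewrite !rmorphM -!mulrA; split; first exact: (VM _ _ Vb).1.
  by rewrite -eAe !mulrA; do 2!apply: (VM _ _ _).2.
have [h [k [Hh Jk hk1]]] := simple_factor_comaximal AJ_simple idH Va nJa.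
by rewrite -[e]mul1r -(rmorph1 phi) hk1 rmorphD mulrDl (Je Jk) addr0.
Qed.

(** The ring is the direct sum of the [E i C]. Non-zero right ideals inside [E i C] contain sets
    [x^i phi (a A) e] and [x^i phi (b A) e] with [a], [b] outside [J]; the Ore condition gives a
    common multiple, non-zero since [A/J] is a domain. *)
Lemma gwa_factor_goldie_rank : right_goldie_rank C n.+1.
Proof.
(* This is [E i C], written as the fixed points of the idempotent. *)
pose U (i : 'I_n.+1) : set C := [set v | E i * v = v].
have leo (i : 'I_n.+1) : (i <= n)%N by rewrite -ltnS.
have UE i : U i (E i) by rewrite /U /= gwa_idem_orth // eqxx.
have EU (i k : 'I_n.+1) v : U k v -> E i * v = if i == k then v else 0.
  move=> vE; rewrite -[in LHS]vE mulrA gwa_idem_orth // -val_eqE.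
  by case: eqP => [->|]; rewrite ?mul0r.
have Ur i : right_ideal (U i).
  split; rewrite /U /=; first by rewrite mulr0.
    by move=> a b aE bE; rewrite mulrDr aE bE.
  by move=> a r aE; rewrite mulrA aE.
have J1 : ~ (J : set A) 1.
  move=> /Je; rewrite rmorph1 mul1r => e0; apply: xn_neq0.
  by rewrite -xne e0 mulr0.
exists U; split=> [i|a Ua a0 i|].
- split.
    split=> // U0; have : [set 0] (E i) by rewrite -U0.
    move=> /= Ei0; apply: (gwa_idem_neq0 (leo i) J1).
    by rewrite -(gwa_idem_retract 1 (leo i)) mulrA -/(E i) Ei0 mul0r.
  move=> V W.
  have corner (V' : set C) : nonzero_right_ideal V' -> V' `<=` U i ->
      exists a, ~ (J : set A) a /\ forall b, V' (x ^+ i * (phi (a * b) * e)).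
    move=> [[V0 VD VM] nV0] VU.
    have [v [Vv v0]] : exists v, V' v /\ v <> 0.
      apply: contrapT => nex; apply: nV0; apply/seteqP.
      split=> [v Vv /=|_ ->] //.
      by apply: contrapT => v0; apply: nex; exists v.
    have [j [_ vj]] := gwa_right_split v0.
    have [a aE] := gwa_idem_corner (leo i) (VU _ Vv) j.
    exists a; split; first by move=> /Je a0; apply: vj; rewrite aE a0 mulr0.
    move=> b; rewrite rmorphM -mulrA -eAe !mulrA -(mulrA _ (phi a)) -aE.
    by do 4!apply: (VM _ _).
  move=> nV nW /(corner _ nV) [a [nJa Va]] /(corner _ nW) [b [nJb Wb]] VW.
  have [s [r [nJr Jab]]] := ore_factor AJ_ore a nJb.
  have : [set 0] (x ^+ i * (phi (a * r) * e)).
    rewrite -VW; split=> //.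
    have -> : phi (a * r) * e = phi (b * s) * e; last by [].
    by apply/subr0_eq; rewrite -mulrBl -rmorphB Je.
  by apply: gwa_idem_neq0 => // /(domain_factor AJ_ore)[].
- have := congr1 ( *%R (E i)) a0; rewrite mulr0 mulr_sumr (bigD1 i) //= big1.
    by rewrite (EU _ _ _ (Ua i)) eqxx addr0.
  by move=> k ki; rewrite (EU _ _ _ (Ua k)) eq_sym (negPf ki).
have -> : [set b | exists2 a : 'I_n.+1 -> C, forall i, U i (a i) &
              b = \sum_(i < n.+1) a i] = [set: C].
  apply/seteqP; split=> // c _; exists (fun i => E i * c).
    by move=> i; have [_ _ UM] := Ur i; apply: UM.
  by rewrite -mulr_suml gwa_idem_sum mul1r.
by split=> [|V [_]]; rewrite ?setIT.
Qed.

End GwaFactor.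

(** * Skew polynomials as coefficient lists over a free basis *)

Lemma free_left_basis_inj (S T : nzRingType) (io : {rmorphism S -> T})
  (J : choiceType) (b : J -> T) (h : nat -> J) (p : {poly S}) :
  free_left_basis io b -> injective h ->
  \sum_(i < size p) io p`_i * b (h i) = 0 -> p = 0.
Proof.
move=> free hinj p0.
pose s := [seq h i | i <- iota 0 (size p)].
have us : uniq s by rewrite map_inj_uniq ?iota_uniq.
pose D : {fset J} := [fset j in s]%fset.
pose c : {fsfun J -> S with 0} := [fsfun j in D => p`_(index j s)].
have cE i : (i < size p)%N -> c (h i) = p`_i.
  move=> ip; have hs : h i \in s by rewrite map_f // mem_iota.
  rewrite fsfunE inE /= hs index_map // -{1}[i]add0n -(nth_iota 0 0 ip).
  by rewrite index_uniq ?iota_uniq ?size_iota.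
have csum : \sum_(j <- finsupp c) io (c j) * b j = 0.
  rewrite (big_fset_incl _ (finsupp_sub _ _ _)) /= => [|j _ /fsfun_dflt ->];
    last by rewrite rmorph0 mul0r.
  rewrite -[RHS]p0 eq_big_imfset /=; last by [].
  rewrite map_id undup_id // big_map.
  rewrite -(big_mkord xpredT (fun i => io p`_i * b (h i))) /index_iota subn0.
  by apply: eq_big_seq => i; rewrite mem_iota => /cE ->.
(* Both [c] and the empty function express [0], so uniqueness identifies them. *)
have [c0 [_ c0u]] := free 0.
have cc0 : c0 = c by apply: c0u; rewrite csum.
have c00 : c0 = [fsfun] by apply: c0u; rewrite finsupp0 big_seq_fset0.
apply/polyP => i; rewrite coef0; have [ip|ip] := ltnP i (size p).
  by rewrite -cE // -cc0 c00 fsfunE.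
by rewrite nth_default.
Qed.

Lemma free_left_basis_ind (S T : nzRingType) (io : {rmorphism S -> T})
  (J : choiceType) (b : J -> T) (M : set T) :
  free_left_basis io b -> M 0 -> (forall c d, M c -> M d -> M (c + d)) ->
  (forall s j, M (io s * b j)) -> forall r, M r.
Proof.
move=> free M0 MD Mb r; have [c [-> _]] := free r.
by apply: (big_ind M) => // j _; apply: Mb.
Qed.

(** Coefficients stand to the left of the powers of [t]. In general this is not multiplicative; it
    respects constants on the left and ['X] on the right. *)
Definition skew_eval (S T : nzRingType) (io : {rmorphism S -> T}) (t : T)
  (p : {poly S}) : T := (map_poly io p).[t].

Section SkewEval.
Variables (S T : nzRingType) (io : {rmorphism S -> T}) (t : T).
Local Notation ev := (skew_eval io t).

Lemma skew_eval0 : ev 0 = 0.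
Proof. by rewrite /skew_eval rmorph0 horner0. Qed.

Lemma skew_evalD p q : ev (p + q) = ev p + ev q.
Proof. by rewrite /skew_eval rmorphD hornerD. Qed.

Lemma skew_evalC s : ev s%:P = io s.
Proof. by rewrite /skew_eval map_polyC hornerC. Qed.

Lemma skew_evalMX p : ev (p * 'X) = ev p * t.
Proof. by rewrite /skew_eval rmorphM /= map_polyX hornerMX. Qed.

Lemma skew_evalCM s p : ev (s%:P * p) = io s * ev p.
Proof. by rewrite /skew_eval rmorphM /= map_polyC hornerCM. Qed.

Lemma skew_evalXn n : ev 'X^n = t ^+ n.
Proof. by rewrite /skew_eval map_polyXn hornerXn. Qed.

Lemma skew_evalE p : ev p = \sum_(i < size p) io p`_i * t ^+ i.
Proof.
rewrite /skew_eval (horner_coef_wide _ (size_poly _ _)).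
by apply: eq_bigr => i _; rewrite coef_map.
Qed.

(** The map [h] selects exponents, so that powers of [t] and of its inverse inside a Laurent basis
    are both covered. *)
Lemma skew_eval_basis_inj (J : choiceType) (b : J -> T) (h : nat -> J) :
  free_left_basis io b -> injective h -> (forall i, b (h i) = t ^+ i) ->
  injective ev.
Proof.
move=> free hinj bh p q pq; apply/subr0_eq/(free_left_basis_inj free hinj).
under eq_bigr => i _ do rewrite bh.
have pqK : ev (p - q) + ev q = ev q by rewrite -skew_evalD subrK pq.
by rewrite -skew_evalE -[LHS](addrK (ev q)) pqK subrr.
Qed.

Hypothesis free : free_left_basis io (fun n : nat => t ^+ n).

Lemma skew_eval_surj r : exists p, r = ev p.
Proof.
apply: (free_left_basis_ind (M := fun r => exists p, r = ev p) free).
- by exists 0; rewrite skew_eval0.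
- by move=> c d [p ->] [q ->]; exists (p + q); rewrite skew_evalD.
- by move=> s j; exists (s%:P * 'X^j); rewrite skew_evalCM skew_evalXn.
Qed.

Lemma skew_eval_inj : injective ev.
Proof. exact: (skew_eval_basis_inj free (@inj_id _)). Qed.

End SkewEval.

(** * Powers of [b] in ideals, from simplicity of the Laurent ring *)

Section SimpleLaurent.
Variables (A B : nzRingType) (L : unitRingType).
Variables (inL : {rmorphism A -> L}) (w : L) (io : {rmorphism A -> B}) (b : B).
Variables (sg sgI : A -> A).
Hypothesis w_unit : w \is a GRing.unit.
Hypothesis wA : forall a, w * inL a = inL (sg a) * w.
Hypothesis Aw : forall a, inL a * w = w * inL (sgI a).
Hypothesis bA : forall a, b * io a = io (sg a) * b.
Hypothesis L_ind : forall M : set L, M 0 ->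
  (forall c d, M c -> M d -> M (c + d)) ->
  (forall a (k : int), M (inL a * w ^ k)) -> forall l, M l.
Hypothesis evL_inj : injective (skew_eval inL w).
Hypothesis L_simple : simple_ring L.

(** Graph of the map from polynomials in [w] to polynomials in [b]; as a relation it spares the
    construction of a homomorphism. *)
Let G (l : L) (c : B) := exists p, l = skew_eval inL w p /\ c = skew_eval io b
  p.

Let GD l c l' c' : G l c -> G l' c' -> G (l + l') (c + c').
Proof. by move=> [p [-> ->]] [q [-> ->]]; exists (p + q);
  rewrite !skew_evalD. Qed.

Let GAl a l c : G l c -> G (inL a * l) (io a * c).
Proof. by move=> [p [-> ->]]; exists (a%:P * p); rewrite !skew_evalCM. Qed.

Let GXr l c : G l c -> G (l * w) (c * b).
Proof. by move=> [p [-> ->]]; exists (p * 'X); rewrite !skew_evalMX. Qed.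

Let GC a : G (inL a) (io a).
Proof. by exists a%:P; rewrite !skew_evalC. Qed.

Let G_ind (N : L -> B -> Prop) : N 0 0 -> (forall l c a, N l c ->
  N (l * w + inL a) (c * b + io a)) -> forall l c, G l c -> N l c.
Proof.
move=> N0 NX l c [p [-> ->]]; elim/poly_ind: p => [|p a IH].
  by rewrite !skew_eval0.
by rewrite !skew_evalD !skew_evalMX !skew_evalC; apply: NX.
Qed.

Let G0 : G 0 0. Proof. by have := GC 0; rewrite !rmorph0. Qed.

Let GXl l c : G l c -> G (w * l) (b * c).
Proof.
move: l c; apply: G_ind => [|l c a IH]; first by rewrite !mulr0.
by rewrite !mulrDr !mulrA wA bA; apply: GD; apply: GXr.
Qed.

Let GAr l c a : G l c -> G (l * inL a) (c * io a).
Proof.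
move=> Glc; move: l c Glc a; apply: (@G_ind (fun l c => forall a, G _ _)).
  by move=> a; rewrite !mul0r.
move=> l c d IH a; rewrite !mulrDl -!mulrA wA bA -!rmorphM !mulrA.
by apply: GD => //; apply: GXr.
Qed.

Let GXX i j l c : G l c -> G (w ^+ i * l * w ^+ j) (b ^+ i * c * b ^+ j).
Proof.
move=> Glc; have {}Glc : G (w ^+ i * l) (b ^+ i * c).
  elim: i => [|i IH]; first by rewrite !expr0 !mul1r.
  by rewrite !exprS -!mulrA; apply: GXl.
elim: j => [|j IH]; first by rewrite !expr0 !mulr1.
by rewrite !exprSr !mulrA; apply: GXr.
Qed.

Let wXA i a : w ^+ i * inL a = inL (iter i sg a) * w ^+ i.
Proof.
elim: i => [|i IH]; first by rewrite mul1r mulr1.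
by rewrite exprS -mulrA IH mulrA wA -!mulrA -exprS.
Qed.

Let AwX i a : inL a * w ^+ i = w ^+ i * inL (iter i sgI a).
Proof.
elim: i => [|i IH]; first by rewrite mul1r mulr1.
by rewrite exprSr mulrA IH -mulrA Aw mulrA -exprSr.
Qed.

(* The ideal of [L] generated by the image of [Q] contains [1]; clearing the
   denominators of that relation on both sides needs no Ore condition. *)
Lemma simple_laurent_power (Q : ideal B) p :
  p <> 0 -> (Q : set B) (skew_eval io b p) -> exists N, (Q : set B) (b ^+ N).
Proof.
move=> p0 Qp.
(* The elements of [L] that, once denominators are cleared on both sides, correspond to an element
   of [Q]. *)
pose V := [set l | exists N M c, G (w ^+ N * l * w ^+ M) c /\ (Q : set B) c].
have V0 : V 0 by exists 0, 0, 0; rewrite mulr0 mul0r; split=> //; apply: ideal0.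
have VD l l' : V l -> V l' -> V (l + l').
  move=> [N [M [c [Gc Qc]]]] [N' [M' [c' [Gc' Qc']]]].
  exists (N + N')%N, (M + M')%N, (b ^+ N' * c * b ^+ M' + b ^+ N * c' * b ^+ M).
  split; last by apply: idealD; apply: idealMr; apply: idealMl.
  have := GD (GXX N' M' Gc) (GXX N M Gc').
  by rewrite !mulrA -!exprD -!(mulrA (_ * _)) -!exprD (addnC N') (addnC M')
    mulrDr mulrDl.
have VAl a l : V l -> V (inL a * l).
  move=> [N [M [c [Gc Qc]]]]; exists N, M, (io (iter N sg a) * c).
  by split; [rewrite mulrA wXA -!mulrA; apply: GAl; rewrite mulrA |
    apply: idealMl].
have VAr a l : V l -> V (l * inL a).
  move=> [N [M [c [Gc Qc]]]]; exists N, M, (c * io (iter M sgI a)).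
  by split; [rewrite -!mulrA AwX !mulrA; apply: GAr | apply: idealMr].
have Vw l : V l -> V (w * l) /\ V (l * w).
  move=> [N [M [c [Gc Qc]]]]; split.
    exists N, M, (b * c); split; last exact: idealMl.
    by rewrite mulrA -exprSr exprS -!mulrA; apply: GXl; rewrite mulrA.
  exists N, M, (c * b); split; last exact: idealMr.
  by rewrite -!mulrA -exprS exprSr !mulrA; apply: GXr.
have VwV l : V l -> V (w^-1 * l) /\ V (l * w^-1).
  move=> [N [M [c [Gc Qc]]]]; split.
    by exists N.+1, M, c; rewrite exprSr -!mulrA mulVKr // mulrA.
  by exists N, M.+1, c; rewrite exprS -!mulrA mulKr // mulrA.
have VwX l (k : int) : V l -> V (w ^ k * l) /\ V (l * w ^ k).
  move=> Vl; case: k => k.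
    rewrite -exprnP; elim: k => [|k [IHl IHr]];
      first by rewrite expr0 mul1r mulr1.
    by split; [rewrite exprS -mulrA; apply: (Vw _ IHl).1 |
      rewrite exprSr mulrA; apply: (Vw _ IHr).2].
  rewrite NegzE -exprnN -exprVn; elim: k.+1 => [|i [IHl IHr]].
    by rewrite expr0 mul1r mulr1.
  by split; [rewrite exprS -mulrA; apply: (VwV _ IHl).1 |
      rewrite exprSr mulrA; apply: (VwV _ IHr).2].
have idV : is_ideal V.
  split=> // r l Vl; apply: (L_ind (M := fun r => V (r * l) /\ V (l * r))).
  - by rewrite mul0r mulr0.
  - by move=> c d [? ?] [? ?]; rewrite mulrDl mulrDr; split; apply: VD.
  - move=> a k; split; first by rewrite -mulrA; apply: VAl;
    apply: (VwX _ _ Vl).1.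
    by rewrite mulrA; apply: (VwX _ _ (VAr _ _ Vl)).2.
have Vp : V (skew_eval inL w p).
  by exists 0, 0, (skew_eval io b p); rewrite mul1r mulr1; split=> //; exists p.
have [VE|VE] := L_simple.2 V idV.
  move: Vp; rewrite VE /= => ev0; case: p0; apply: evL_inj.
  by rewrite ev0 skew_eval0.
have : V 1 by rewrite VE.
move=> [N [M [c [[q [qE cE]] Qc]]]]; exists (N + M)%N.
(* Membership of [1] in [V] gives a [q] with value [w^(N+M)] at [w]; injectivity determines [q], so
   its value at [b] is a power of [b] in [Q]. *)
have qX : q = 'X^(N + M).
  by apply: evL_inj; rewrite -qE skew_evalXn mulr1 exprD.
by rewrite -(skew_evalXn io) -qX -cE.
Qed.

End SimpleLaurent.

(** * The conformal ambiskew ring modulo [zl], which stands for [z - lambda] *)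

Section Conformal.
Variables (A T R : nzRingType) (alpha : {rmorphism A -> A}) (alphaI : A -> A).
Variables (f : A) (inT : {rmorphism A -> T}) (y : T).
Variables (inR : {rmorphism T -> R}) (x : R).
Hypothesis alphaK : cancel alpha alphaI.
Hypothesis alphaIK : cancel alphaI alpha.
Hypothesis A_domain : is_domain A.
Hypothesis f_central : center A f.
Hypothesis f_neq0 : f <> 0.
Hypothesis T_basis : free_left_basis inT (fun n : nat => y ^+ n).
Hypothesis R_basis : free_left_basis inR (fun n : nat => x ^+ n).
Hypothesis yA : forall a, y * inT a = inT (alpha a) * y.
Hypothesis xA : forall a, x * inR (inT (alpha a)) = inR (inT a) * x.
Hypothesis xy : x * inR y = inR y * x + inR (inT (f - alpha f)).

Local Notation Y := (inR y).
Variable zl : R.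
Hypothesis zl_def : zl = x * Y - inR (inT f).

Let zlE : zl = Y * x - inR (inT (alpha f)).
Proof. by rewrite zl_def xy !rmorphB /= [X in _ + X - _]addrC addrA addrK. Qed.

Lemma ambiskew_T_ind (M : set T) : M 0 -> (forall s a, M s ->
  M (s * y + inT a)) ->
  forall s, M s.
Proof.
move=> M0 MX s; have [p ->] := skew_eval_surj T_basis s.
elim/poly_ind: p => [|p a IH]; first by rewrite skew_eval0.
by rewrite skew_evalD skew_evalMX skew_evalC; apply: MX.
Qed.

Lemma ambiskew_R_ind (M : set R) : M 0 -> (forall r s, M r ->
  M (r * x + inR s)) ->
  forall r, M r.
Proof.
move=> M0 MX r; have [p ->] := skew_eval_surj R_basis r.
elim/poly_ind: p => [|p a IH]; first by rewrite skew_eval0.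
by rewrite skew_evalD skew_evalMX skew_evalC; apply: MX.
Qed.

(** The twists of [x] and [y] cancel on [A] and [f] is central; for [Y], compare the two forms
    [x Y - f] and [Y x - alpha f]. *)
Lemma casimir_comm s : zl * inR s = inR s * zl.
Proof.
have zY : zl * Y = Y * zl.
  by rewrite {1}zlE zl_def mulrBl mulrBr !mulrA -!rmorphM yA.
have zA a : zl * inR (inT a) = inR (inT a) * zl.
  rewrite zl_def mulrBl mulrBr -!rmorphM f_central; congr (_ - _).
  by rewrite -mulrA -rmorphM yA rmorphM mulrA xA mulrA.
move: s; apply: ambiskew_T_ind => [|s a IH];
  first by rewrite rmorph0 mulr0 mul0r.
by rewrite rmorphD rmorphM mulrDr mulrDl mulrA IH zA -!mulrA zY.
Qed.

Lemma ambiskew_yT s : exists s', y * s = s' * y.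
Proof.
move: s; apply: ambiskew_T_ind => [|s a [s' IH]]; first by exists 0;
  rewrite mulr0 mul0r.
by exists (s' * y + inT (alpha a)); rewrite mulrDr mulrDl mulrA IH yA.
Qed.

Lemma ambiskew_Ty s : exists s', s * y = y * s'.
Proof.
move: s; apply: ambiskew_T_ind => [|s a [s' IH]]; first by exists 0;
  rewrite mulr0 mul0r.
exists (s' * y + inT (alphaI a)).
by rewrite mulrDr mulrDl mulrA IH -{1}(alphaIK a) -yA.
Qed.

Lemma ambiskew_Ty_eq0 s : s * y = 0 -> s = 0.
Proof.
have [p ->] := skew_eval_surj T_basis s; rewrite -skew_evalMX => p0.
have : p * 'X = 0 by apply: (skew_eval_inj T_basis); rewrite p0 skew_eval0.
move=> pX; suff -> : p = 0 by rewrite skew_eval0.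
by apply/polyP => i; have /(congr1 (coefp i.+1)) := pX;
  rewrite /= coefMX !coef0.
Qed.

Lemma ambiskew_yT_eq0 s : y * s = 0 -> s = 0.
Proof.
have [p ->] := skew_eval_surj T_basis s.
suff -> : y * skew_eval inT y p = skew_eval inT y (map_poly alpha p) * y.
  move=> /ambiskew_Ty_eq0 p0.
  suff -> : p = 0 by rewrite skew_eval0.
  have ap0 : map_poly alpha p = 0.
    by apply: (skew_eval_inj T_basis); rewrite p0 skew_eval0.
  apply/polyP => i; rewrite coef0 -[p`_i]alphaK -coef_map ap0 coef0.
  by rewrite -[in LHS](rmorph0 alpha) alphaK.
elim/poly_ind: p => [|p a IH]; first by rewrite rmorph0 !skew_eval0 mulr0 mul0r.
rewrite rmorphD rmorphM /= map_polyX map_polyC !skew_evalD !skew_evalMX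
  !skew_evalC.
by rewrite mulrDr mulrDl mulrA IH yA.
Qed.

Let y_neq0 : y <> 0.
Proof.
move=> y0; have /eqP := oner_neq0 T; apply.
by apply: ambiskew_yT_eq0; rewrite y0 mul0r.
Qed.

(** [zl] as a polynomial in [x]. Since [zl] commutes with [T], left multiplication by [zl] becomes
    right multiplication by [D] in the ordinary polynomial ring, where degrees can be counted. *)
Let D : {poly T} := y%:P * 'X + (- inT (alpha f))%:P.

Let zl_ev p : zl * skew_eval inR x p = skew_eval inR x (p * D).
Proof.
elim/poly_ind: p => [|p s IH]; first by rewrite mul0r !skew_eval0 mulr0.
rewrite skew_evalD mulrDr skew_evalMX mulrA IH mulrDl skew_evalD skew_evalC.
rewrite -mulrA -commr_polyX mulrA skew_evalMX; congr (_ + _).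
by rewrite skew_evalCM casimir_comm zlE /D skew_evalD skew_evalMX !skew_evalC
  rmorphN.
Qed.

(** [D] has degree one in [x] and its leading coefficient [y] is regular, so no multiple [p D] is
    the constant [1]. *)
Lemma casimir_not_unit r : zl * r <> 1.
Proof.
have [p ->] := skew_eval_surj R_basis r; rewrite zl_ev => pD.
have {}pD : p * D = 1.
  by apply: (skew_eval_inj R_basis); rewrite pD -polyC1 skew_evalC rmorph1.
have p0 : p != 0.
  by apply/eqP => p0; have /eqP := oner_neq0 {poly T}; rewrite -pD p0 mul0r.
have yN0 : y != 0 by apply/eqP.
have sD : size D = 2.
  by rewrite /D size_MXaddC polyC_eq0 (negPf yN0) size_polyC yN0.
have lD : lead_coef D = y.
  rewrite /D lead_coefDl; first by rewrite lead_coefMX lead_coefC.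
  by rewrite size_mulX ?polyC_eq0 // ltnS !size_polyC yN0 leq_b1.
have := congr1 (fun q : {poly T} => size q) pD; rewrite size_proper_mul.
  by rewrite sD size_poly1 addn2 /= => -[/eqP];
    rewrite size_poly_eq0 (negPf p0).
apply/eqP; rewrite lD => /ambiskew_Ty_eq0/eqP.
by rewrite lead_coef_eq0 (negPf p0).
Qed.

Lemma ambiskew_yR_eq0 r : Y * r = 0 -> r = 0.
Proof.
have [p ->] := skew_eval_surj R_basis r; rewrite -skew_evalCM => yp0.
have {}yp0 : y%:P * p = 0.
  by apply: (skew_eval_inj R_basis); rewrite yp0 skew_eval0.
suff -> : p = 0 by rewrite skew_eval0.
apply/polyP => i; rewrite coef0; apply: ambiskew_yT_eq0.
by rewrite -coefCM yp0 coef0.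
Qed.

Let alpha_f_reg a : alpha f * a = 0 -> a = 0.
Proof.
case/A_domain.2 => // af0; case: f_neq0.
by rewrite -[f]alphaK af0 -[in LHS](rmorph0 alpha) alphaK.
Qed.

(** As [y T] is contained in [T y], comparing constant coefficients gives [alpha(f) p_0 = 0], hence
    [p_0 = 0]; the left factor is then moved across [y]. *)
Lemma ambiskew_yT_colon s s' : inT (alpha f) * s = y * s' ->
  exists s'', s = y * s''.
Proof.
have [p ->] := skew_eval_surj T_basis s.
have [s1 ->] := ambiskew_yT s'; have [q ->] := skew_eval_surj T_basis s1.
rewrite -skew_evalMX -skew_evalCM => /(skew_eval_inj T_basis) pq.
have p0 : p`_0 = 0.
  by apply: alpha_f_reg; rewrite -coefCM pq coefMX.
have [p' ->] : exists p', p = p' * 'X.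
  exists (\poly_(i < (size p).-1) p`_i.+1).
  apply/polyP => -[|i]; rewrite coefMX //= coef_poly.
  by case: ltnP => // ip; rewrite nth_default //; case: (size p) ip.
by rewrite skew_evalMX; apply: ambiskew_Ty.
Qed.

Lemma ambiskew_yR_colon r r' : inR (inT (alpha f)) * r = Y * r' ->
  exists r'', r = Y * r''.
Proof.
have [p ->] := skew_eval_surj R_basis r; have [q ->] :=
  skew_eval_surj R_basis r'.
rewrite -!skew_evalCM => /(skew_eval_inj R_basis) pq.
rewrite skew_evalE; apply: (big_ind (fun r => exists r'', r = Y * r'')).
- by exists 0; rewrite mulr0.
- by move=> _ _ [a ->] [b ->]; exists (a + b); rewrite mulrDr.
move=> i _; have [|s ->] := @ambiskew_yT_colon p`_i q`_i.
  by rewrite -!coefCM pq.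
by exists (inR s * x ^+ i); rewrite rmorphM mulrA.
Qed.

Variable I : ideal R.
Hypothesis IE : I = principal_right zl :> set R.

Lemma casimir_proper : ~ (I : set R) 1.
Proof. by rewrite IE => -[r _ /casimir_not_unit]. Qed.

(** If [Y q = zl r], then [alpha(f) r = Y (x r - q)], so [r = Y r']; as [zl] commutes with [Y],
    cancelling [Y] leaves [q = zl r']. *)
Lemma casimir_ycancel q : (I : set R) (Y * q) -> (I : set R) q.
Proof.
rewrite IE => -[r _ zr].
have [|r' rE] := @ambiskew_yR_colon r (x * r - q).
  by rewrite mulrBr -zr zlE mulrBl -!mulrA opprB addrCA subrr addr0.
exists r' => //; apply/subr0_eq/ambiskew_yR_eq0.
by rewrite mulrBr -zr rE !mulrA casimir_comm subrr.
Qed.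

Let Izl : (I : set R) zl.
Proof. by rewrite IE; exists 1; rewrite ?mulr1. Qed.

(** Modulo [I], [Y x] is [alpha f], so each factor [Y] on the left removes one [x]. *)
Lemma casimir_clear_x q : exists N s, (I : set R) (Y ^+ N * q - inR s).
Proof.
move: q; apply: ambiskew_R_ind => [|q s [N [s' IH]]].
  by exists 0, 0; rewrite rmorph0 mulr0 subr0; apply: ideal0.
have [s1 s1E] := ambiskew_yT s'.
exists N.+1, (s1 * inT (alpha f) + y ^+ N.+1 * s).
have -> : Y ^+ N.+1 * (q * x + inR s)
        - inR (s1 * inT (alpha f) + y ^+ N.+1 * s) =
    Y * (Y ^+ N * q - inR s') * x + inR s1 * zl.
  rewrite zlE mulrBr mulrBl mulrBr -rmorphM s1E !rmorphD !rmorphM rmorphXn /=.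
  rewrite mulrDr opprD addrACA subrr addr0 exprS !mulrA.
  by rewrite addrA subrK.
by apply: idealD; [apply: idealMr; apply: idealMl | apply: idealMl].
Qed.

(** Clearing [x] from an element of [Q] outside [I] lands in [A[y; alpha]]; the result is non-zero
    because [Y] can be cancelled modulo [I]. *)
Lemma casimir_over_poly (Q : ideal R) : I `<=` Q -> Q <> I :> set R ->
  exists p, p <> 0 /\ (Q : set R) (skew_eval (inR \o inT) Y p).
Proof.
move=> IQ QI.
have [q [Qq Iq]] : exists q, (Q : set R) q /\ ~ (I : set R) q.
  apply: contrapT => nex; apply: QI; apply/seteqP; split=> // q Qq.
  by apply: contrapT => Iq; apply: nex; exists q.
have [N [s Is]] := casimir_clear_x q.
have [p pE] := skew_eval_surj T_basis s.
have sE : inR s = skew_eval (inR \o inT) Y p.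
  by rewrite pE /skew_eval -horner_map -map_poly_comp.
exists p; split.
  move=> p0; apply: Iq; move: Is; rewrite pE p0 skew_eval0 rmorph0 subr0.
  by elim: N => [|N IH]; rewrite ?mul1r // exprS -mulrA => /casimir_ycancel.
rewrite -sE; have -> : inR s = Y ^+ N * q - (Y ^+ N * q - inR s) by rewrite
  subKr.
by apply: idealD; [apply: idealMl | apply/idealN/IQ].
Qed.

(** Turns a power of [Y] in an ideal above [I] into a non-zero element of [A]. The inductive step is
    [x a Y = alphaI(a) x Y], which is [alphaI(a) f] modulo [I]. *)
Lemma casimir_xy_pow N : exists a, a <> 0 /\
  (I : set R) (x ^+ N * Y ^+ N - inR (inT a)).
Proof.
elim: N => [|N [a [a0 IH]]].
  exists 1; split; first exact: A_domain.1.
  by rewrite mulr1 !rmorph1 subrr; apply: ideal0.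
exists (alphaI a * f); split.
  case/A_domain.2 => // /(congr1 alpha); rewrite alphaIK rmorph0.
  exact: a0.
have -> : x ^+ N.+1 * Y ^+ N.+1 - inR (inT (alphaI a * f)) =
    x * (x ^+ N * Y ^+ N - inR (inT a)) * Y + inR (inT (alphaI a)) * zl.
  have xa : x * inR (inT a) = inR (inT (alphaI a)) * x by rewrite -xA alphaIK.
  rewrite zl_def !mulrBr !mulrBl xa !rmorphM exprS exprSr !mulrA.
  by rewrite addrA subrK.
by apply: idealD; [apply: idealMr; apply: idealMl | apply: idealMl].
Qed.

Lemma casimir_gwa_rel (W : ideal R) : I `<=` W ->
  gwa_rel alpha f (factor_map W \o (inR \o inT)) (factor_map W x) (factor_map
    W Y).
Proof.
move=> IW; split=> [a|a||] /=; rewrite -!rmorphM /=.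
- by rewrite yA rmorphM.
- by rewrite xA.
- by apply/factor_mapP; rewrite -zl_def; apply: IW.
- by apply/factor_mapP; rewrite -zlE; apply: IW.
Qed.

(** [A], [x] and [Y] generate the ring, phrased as a stability principle for left multiplication. *)
Lemma ambiskew_gen (W : ideal R) (M : set (factor_ring W)) : M 0 ->
  (forall c d, M c -> M d -> M (c + d)) ->
  (forall a c, M c -> M (factor_map W (inR (inT a)) * c)) ->
  (forall c, M c -> M (factor_map W x * c)) ->
  (forall c, M c -> M (factor_map W Y * c)) -> forall c v, M v -> M (c * v).
Proof.
move=> M0 MD MA Mx My c; have [r ->] := factor_map_surj c.
have MT s v : M v -> M (factor_map W (inR s) * v).
  move: s v; apply: (ambiskew_T_ind (M := fun s => forall v, M v -> M _)).
    by move=> v _; rewrite !rmorph0 mul0r.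
  move=> s a IH v Mv; rewrite !rmorphD !rmorphM mulrDl -mulrA.
  by apply: MD; [apply/IH/My | apply: MA].
move: r; apply: (ambiskew_R_ind (M := fun r => forall v, M v -> M _)).
  by move=> v _; rewrite rmorph0 mul0r.
move=> r s IH v Mv; rewrite rmorphD rmorphM mulrDl -mulrA.
by apply: MD; [apply/IH/Mx | apply: MT].
Qed.

End Conformal.

(** * Primes, intersections and annihilators in factor rings *)

Lemma factor_imageP (R : pzRingType) (I P : ideal R) r :
  I `<=` P -> (factor_map I @` P) (factor_map I r) <-> (P : set R) r.
Proof.
move=> IP; split=> [[s Ps /factor_mapP /IP Psr]|Pr]; last by exists r.
by rewrite -[r](subKr s); apply: idealD => //; apply: idealN.
Qed.

(** If neither ideal lies below [P], both are comaximal with it, and multiplying the two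
    decompositions of [1] puts [1] in [P]. *)
Lemma simple_factor_prime (R : pzRingType) (I P : ideal R) :
  I `<=` P -> simple_ring (factor_ring P) -> prime_ideal (factor_map I @` P).
Proof.
move=> IP simP; have P1 : ~ (P : set R) 1.
  by move/factor_map0; rewrite rmorph1; apply: simP.1.
have idP := image_is_ideal (@factor_map_surj _ I) (idealP P).
split=> // [PT|I1 I2 id1 id2 I12].
  by apply/P1/(factor_imageP 1 IP); rewrite PT.
apply: contrapT => /not_orP[n1 n2].
have comax (H : set (factor_ring I)) : is_ideal H ->
  ~ H `<=` factor_map I @` P ->
    exists h p, [/\ H (factor_map I h), (P : set R) p & 1 = h + p].
  move=> idH nHP; have [r [Hr Pr]] : exists r, H (factor_map I r) /\ ~ (P :
    set R) r.
    apply: contrapT => nex; apply: nHP => q Hq.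
    have [r rE] := factor_map_surj q; rewrite rE; apply/(factor_imageP r IP).
    by apply: contrapT => Pr; apply: nex; exists r; rewrite -rE.
  have [h [p [Hh Pp hp1]]] :=
    simple_factor_comaximal simP (preimage_is_ideal (factor_map I) idH) Hr Pr.
  by exists h, p.
have [h1 [p1 [H1 P1' E1]]] := comax _ id1 n1.
have [h2 [p2 [H2 P2' E2]]] := comax _ id2 n2.
apply: P1; have -> : 1 = h1 * h2 + (h1 * p2 + p1) :> R.
  by rewrite addrA -mulrDr -E2 mulr1.
apply: idealD; last by apply: idealD => //; apply: idealMl.
by apply/(factor_imageP _ IP); rewrite rmorphM; apply: I12.
Qed.

Lemma is_ideal_bigcap (R : pzRingType) (S : set (ideal R)) :
  is_ideal [set r | forall Q : ideal R, S Q -> (Q : set R) r].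
Proof.
split=> [Q _|a b Wa Wb Q SQ|r a Wa]; first exact: ideal0.
  by apply: idealD; [apply: Wa|apply: Wb].
by split=> Q SQ; [apply: idealMl|apply: idealMr]; apply: Wa.
Qed.

Lemma is_ideal_left_annihilator (R : pzRingType) (W : ideal R) c :
  is_ideal [set r | forall s, (W : set R) (r * s * c)].
Proof.
split=> [s|a b Wa Wb s|r a Wa] /=; first by rewrite !mul0r; apply: ideal0.
  by rewrite !mulrDl; apply: idealD.
by split=> s; rewrite -!mulrA; [apply: idealMl; rewrite mulrA |
  rewrite !mulrA -(mulrA a)].
Qed.

Lemma not_maximal_ideal (R : pzRingType) (I : ideal R) :
  ~ (I : set R) 1 -> ~ maximal_ideal I ->
  exists Q : ideal R, [/\ I `<=` Q, Q <> I :> set R & ~ (Q : set R) 1].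
Proof.
move=> I1 nmax; apply: contrapT => nex; apply: nmax; split; first exact: idealP.
  exact/ideal_proper.
move=> H idH IH; apply: contrapT => /not_orP[HI HT]; apply: nex.
by exists (Ideal idH); split=> //; apply/(ideal_proper (Ideal idH)).
Qed.

Theorem corollary4p9 (K : closedFieldType) (A : algType K)
  (A_domain : is_domain A)
  (alpha : {lrmorphism A -> A}) (alpha_bij : bijective alpha)
  (u : A) (u_central : center A u) (u_notin_K : forall k : K, u <> k%:A)
  (T : algType K) (inT : {lrmorphism A -> T}) (y : T)
  (R : algType K) (inR : {lrmorphism T -> R}) (x : R)
  (R_ambiskew : is_ambiskew alpha (u - alpha u) inT y inR x)
  (z : R) (z_casimir : z = x * inR y - inR (inT u))
  (L : unitAlgType K) (inL : {lrmorphism A -> L}) (yL : L)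
  (L_laurent : is_skew_laurent alpha inL yL)
  (L_simple : simple_ring L)
  (L_center : center L = [set k%:A | k in [set: K]])
  (lambda : K)
  (I : ideal R) (I_def : I = principal_right (z - lambda%:A) :> set R)
  (I_not_maximal : ~ maximal_ideal I)
  (m : nat) (m_gt0 : (0 < m)%N)
  (J : ideal A)
  (J_def : J = set_sum (principal_right (u + lambda%:A))
                 (principal_right (iter m alpha (u + lambda%:A))) :> set A)
  (J_proper : (J : set A) <> [set: A])
  (AJ_simple : simple_ring (factor_ring J))
  (AJ_ore : right_ore_domain (factor_ring J))
  (comaximal : forall n : nat, (0 < n)%N -> n <> m ->
     set_sum (principal_right (u + lambda%:A))
       (principal_right (iter n alpha (u + lambda%:A))) = [set: A]) :
  exists P : ideal R,
    [/\ I `<=` P,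
        prime_ideal (factor_map I @` P) /\ factor_map I @` P <> [set 0],
        forall Q : set (factor_ring I),
          prime_ideal Q -> Q <> [set 0] -> Q = factor_map I @` P &
        right_goldie_rank (factor_ring P) m].
Proof.
move: R_ambiskew => [[_ yA0 T_basis] [beta [delta [bA bY dA dY [_ xT
  R_basis]]]]].
have [yL_unit yLA0 L_basis] := L_laurent.
have yLA a : yL * inL a = inL (alpha a) * yL by apply: yLA0.
have [alphaI alphaK alphaIK] := alpha_bij.
set f := u + lambda%:A in J_def comaximal.
have alpha_f : alpha f = alpha u + lambda%:A.
  by rewrite /f linearD linearZ rmorph1.
have f_central : center A f.
  by move=> a; rewrite mulrDl mulrDr u_central -scalerAl mul1r -scalerAr mulr1.
have f_neq0 : f <> 0.
  by move=> /eqP; rewrite addr_eq0 -scaleNr => /eqP /u_notin_K.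
have alpha_surj a : exists b, a = alpha b by exists (alphaI a); rewrite alphaIK.
have yA a : y * inT a = inT (alpha a) * y by rewrite yA0 rmorph0 addr0.
have xA a : x * inR (inT (alpha a)) = inR (inT a) * x.
  by rewrite xT bA dA rmorph0 addr0.
have xy : x * inR y = inR y * x + inR (inT (f - alpha f)).
  rewrite xT bY dY; congr (_ + inR (inT _)).
  by rewrite alpha_f opprD addrACA subrr addr0.
have zl_def : z - lambda%:A = x * inR y - inR (inT f).
  by rewrite z_casimir /f -addrA -opprD !linearD !linearZ !rmorph1.
have cmx k : (0 < k)%N -> k <> m -> comaximal_shift alpha f k.
  move=> k0 km; have : [set: A] 1 by [].
  by rewrite -(comaximal k k0 km) => -[_ [a _ <-] [_ [b _ <-] E]]; exists a, b.
have I_proper : ~ (I : set R) 1.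
  exact: casimir_proper alphaK f_central T_basis R_basis yA xA xy _ zl_def _
    I_def.
have IQ_poly := casimir_over_poly alphaK alphaIK A_domain f_central f_neq0
  T_basis R_basis yA xA xy zl_def I_def.
have I_pow := casimir_xy_pow alphaIK A_domain f_neq0 xA zl_def I_def.
have rel := casimir_gwa_rel yA xA xy zl_def I_def.
have Aw a : inL a * yL = yL * inL (alphaI a) by rewrite yLA alphaIK.
(* The inverse of [yL] twists by [alphaI], as [x] does, so the Laurent argument applies to [x] as
   well. *)
have wVA a : yL^-1 * inL a = inL (alphaI a) * yL^-1.
  by rewrite -[LHS](mulrK yL_unit) -(mulrA _ _ yL) Aw mulKr.
have AwV a : inL a * yL^-1 = yL^-1 * inL (alpha a) by rewrite wVA alphaK.
have L_ind (M : set L) : M 0 -> (forall c d, M c -> M d -> M (c + d)) ->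
    (forall a (k : int), M (inL a * yL ^ k)) -> forall l, M l.
  exact: free_left_basis_ind.
have LV_ind (M : set L) : M 0 -> (forall c d, M c -> M d -> M (c + d)) ->
    (forall a (k : int), M (inL a * yL^-1 ^ k)) -> forall l, M l.
  by move=> M0 MD Mk; apply: L_ind => // a k; rewrite -[k]opprK -exprz_inv.
have ev_inj : injective (skew_eval inL yL).
  by apply: (skew_eval_basis_inj (h := Posz) L_basis) => [i j []|].
have evV_inj : injective (skew_eval inL yL^-1).
  apply: (skew_eval_basis_inj (h := fun n => - n%:Z) L_basis).
    by move=> i j /oppr_inj[].
  by move=> i; rewrite -exprz_inv.
case: m m_gt0 cmx J_def {comaximal} => // n _ cmx J_def.
have index (Q : ideal R) : I `<=` Q -> Q <> I :> set R -> ~ (Q : set R) 1 ->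
    [/\ (Q : set R) (inR y ^+ n.+1), (Q : set R) (x ^+ n.+1) &
        ~ (Q : set R) (x ^+ n)].
  move=> IQ QI Q1; have [p [p0 Qp]] := IQ_poly Q IQ QI.
  have [N QyN] : exists N, (Q : set R) (inR y ^+ N).
    apply: (simple_laurent_power yL_unit yLA Aw _ L_ind ev_inj L_simple p0 Qp).
    by move=> a; rewrite /= -rmorphM yA rmorphM.
  have [a [a0 Ia]] := I_pow N.
  have [N' QxN] : exists N, (Q : set R) (x ^+ N).
    apply: (simple_laurent_power (io := inR \o inT) (p := a%:P) _ wVA AwV _
              LV_ind evV_inj L_simple).
    - by rewrite unitrV.
    - by move=> b; rewrite /= -xA alphaIK.
    - by move=> /polyC_inj.
    (* The constant [a] is the non-zero polynomial fed to the argument for [x]; it lies in [Q]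
       because [Y^N] does. *)
    rewrite skew_evalC /=.
    have -> : inR (inT a) = x ^+ N * inR y ^+ N -
                (x ^+ N * inR y ^+ N - inR (inT a)) by rewrite subKr.
    by apply: idealD; [apply: idealMl | apply/idealN/IQ].
  have C1 : (1 : factor_ring Q) <> 0.
    by rewrite -(rmorph1 (factor_map Q)) factor_map0.
  have [|xn xn1] := gwa_x_index (rel Q IQ) C1 cmx.
    by exists N'; rewrite -rmorphXn factor_map0.
  have yn := gwa_y_index alpha_surj f_central (rel Q IQ) C1 cmx.
  split; rewrite -factor_map0 rmorphXn //.
  by apply: yn; exists N; rewrite -rmorphXn factor_map0.
(* Non-maximality of [I] supplies a proper ideal [Q0] strictly above it, which keeps [x^n] out of
   [W]. *)
have [Q0 [IQ0 Q0I Q01]] := not_maximal_ideal I_proper I_not_maximal.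
pose W := Ideal (is_ideal_bigcap
  [set Q : ideal R | I `<=` Q /\ Q <> I :> set R]).
have WE r : (W : set R) r <->
    forall Q : ideal R, I `<=` Q -> Q <> I :> set R -> (Q : set R) r.
  by split=> [Wr Q IQ QI|Wr Q [IQ QI]]; apply: Wr.
have IW : I `<=` W by move=> r Ir Q [IQ _]; apply: IQ.
(* The family defining [W] contains [R] itself, to which [index] does not apply. *)
have Q_all (Q : ideal R) r : (Q : set R) 1 -> (Q : set R) r.
  by move=> Q1; rewrite -[r]mul1r; apply: idealMr.
have Wyn : (W : set R) (inR y ^+ n.+1).
  apply/WE => Q IQ QI; have [/Q_all//|Q1] := pselect ((Q : set R) 1).
  by have [] := index Q IQ QI Q1.
have Wxn : (W : set R) (x ^+ n.+1).
  apply/WE => Q IQ QI; have [/Q_all//|Q1] := pselect ((Q : set R) 1).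
  by have [] := index Q IQ QI Q1.
have nWxn : ~ (W : set R) (x ^+ n).
  by move=> /WE /(_ Q0 IQ0 Q0I); have [] := index Q0 IQ0 Q0I Q01.
have pow0 (V : ideal R) r k : (V : set R) (r ^+ k) -> factor_map V r ^+ k = 0.
  by move=> Vr; rewrite -rmorphXn factor_map0.
(* The matrix data, applied first to [R/W], make [x^n] von Neumann regular there; this gives [x^n]
   outside [P] and faithfulness modulo [P]. *)
have [t0 Wt0] : exists t, (W : set R) (x ^+ n * t * x ^+ n - x ^+ n).
  have [t' [ep [[_ tx xe _] _ _ _]]] := gwa_matrix_data alpha_surj f_central
    (rel W IW) cmx J_def (pow0 _ _ _ Wxn) (pow0 _ _ _ Wyn).
  have [t tE] := factor_map_surj t'; exists t.
  apply/factor_mapP; rewrite !rmorphM !rmorphXn -mulrA.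
  by move: tx xe; rewrite tE => ->.
pose P := Ideal (is_ideal_left_annihilator W (x ^+ n)).
have WP : W `<=` P by move=> r Wr s; rewrite -mulrA; apply: idealMr.
have IP : I `<=` P by move=> r /IW /WP.
have nPxn : ~ (P : set R) (x ^+ n).
  move=> /(_ t0) Wxtx; apply: nWxn.
  rewrite -[x ^+ n](subKr (x ^+ n * t0 * x ^+ n)).
  by apply: idealD => //; apply: idealN.
have faithful (c : factor_ring P) :
    (forall s, c * s * factor_map P x ^+ n = 0) -> c = 0.
  have [r ->] := factor_map_surj c => r0; apply/factor_map0 => s.
  have Prsx : (P : set R) (r * s * x ^+ n).
    by apply/factor_map0; rewrite !rmorphM rmorphXn.
  have Wr : (W : set R) (r * s * x ^+ n * t0 * x ^+ n) by apply: Prsx.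
  have -> : r * s * x ^+ n = r * s * x ^+ n * t0 * x ^+ n -
              r * s * (x ^+ n * t0 * x ^+ n - x ^+ n).
    by rewrite mulrBr !mulrA subKr.
  apply: (idealD (I := W)); first exact: Wr.
  by apply: (idealN (I := W)); apply: (idealMl (I := W)).
have xnP0 : factor_map P x ^+ n <> 0 by rewrite -rmorphXn factor_map0.
have Pxn := pow0 _ _ _ (WP _ Wxn); have Pyn := pow0 _ _ _ (WP _ Wyn).
have [t [ep [[yt tx xe et] Je eAe txlt]]] := gwa_matrix_data alpha_surj
  f_central (rel P IP) cmx J_def Pxn Pyn.
have gen := ambiskew_gen T_basis R_basis (W := P).
have simP : simple_ring (factor_ring P).
  exact: (gwa_factor_simple (rel P IP) Pxn gen xnP0 faithful AJ_simple yt tx xe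
           et Je eAe txlt).
have P1 : ~ (P : set R) 1.
  by move/factor_map0; rewrite rmorph1; apply: simP.1.
exists P; split=> //; last exact: (gwa_factor_goldie_rank (rel P IP) Pxn gen
  xnP0
  faithful AJ_simple AJ_ore yt tx xe et Je eAe txlt).
  split; first exact: simple_factor_prime.
  (* A zero image would mean [P = I], and then simplicity of [R/P] would make [I] maximal. *)
  move=> P0; apply: I_not_maximal.
  have PI : P = I :> set R.
    apply/seteqP; split=> // r Pr; apply/factor_map0.
    have : (factor_map I @` P) (factor_map I r) by exists r.
    by rewrite P0.
  split; [exact: idealP | exact/ideal_proper |].
  move=> H idH IH; have [HI|] := pselect (H `<=` I).
    by left; apply/seteqP.
  move=> nHI; right.
  have [r [Hr Ir]] : exists r, H r /\ ~ (P : set R) r.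
    apply: contrapT => nex; apply: nHI => r Hr; rewrite -PI.
    by apply: contrapT => Pr; apply: nex; exists r.
  have [h [p [Hh Pp hp]]] := simple_factor_comaximal simP idH Hr Ir.
  apply: contrapT => /(ideal_proper (Ideal idH)); apply=> /=.
  rewrite hp; apply: (idealD (I := Ideal idH)) => //=; apply: IH.
  by rewrite -PI.
move=> Q [idQ QT Qprime] Q0'.
pose Q' := Ideal (preimage_is_ideal (factor_map I) idQ).
have Q'1 : ~ (Q' : set R) 1.
  rewrite /= /preimage /= rmorph1 => Q1.
  by apply/(ideal_proper (Ideal idQ)): Q1.
have IQ' : I `<=` Q'.
  by move=> r /factor_map0 r0; rewrite /= /preimage /= r0; have [] := idQ.
have Q'I : Q' <> I :> set R.
  move=> Q'E; apply: Q0'; apply/seteqP; split=> [q Qq|_ ->]; last by have [] :=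
    idQ.
  have [r rE] := factor_map_surj q; rewrite rE /=; apply/factor_map0.
  by rewrite -Q'E /= /preimage /= -rE.
have [_ _ nQ'xn] := index Q' IQ' Q'I Q'1.
have PQ : factor_map I @` P `<=` Q.
  (* The right multipliers of [P] into [Q]. They include [x^n], since [P x^n] lies in [W] and so in
     [Q']; as [x^n] is not in [Q'], primeness forces [P] into [Q]. *)
  pose H := [set b | forall a, (P : set R) a -> Q (factor_map I a * b)].
  have idH : is_ideal H.
    have [Q_0 QD QM] := idQ; split=> [a _|b c Hb Hc a Pa|r b Hb].
    - by rewrite mulr0.
    - by rewrite mulrDr; apply: QD; [apply: Hb|apply: Hc].
    split=> a Pa; last by rewrite mulrA; apply: (QM _ _ _).2; apply: Hb.
    have [s ->] := factor_map_surj r; rewrite mulrA -rmorphM; apply: Hb.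
    exact: idealMr.
  have HPQ a b : (factor_map I @` P) a -> H b -> Q (a * b).
    by move=> [r Pr <-] Hb; apply: Hb.
  have idPI := image_is_ideal (@factor_map_surj _ I) (idealP P).
  have [//|HQ] := Qprime _ _ idPI idH HPQ.
  case: nQ'xn; apply: HQ => a Pa; rewrite -rmorphM.
  have Wa : (W : set R) (a * x ^+ n) by have := Pa 1; rewrite mulr1.
  exact: (WE _).1 Wa Q' IQ' Q'I.
apply/seteqP; split=> // q Qq.
have [r rE] := factor_map_surj q; rewrite rE; apply/(factor_imageP r IP).
apply: contrapT => nPr.
have Q'r : (Q' : set R) r by rewrite /= /preimage /= -rE.
(* An element of [Q'] outside [P] would make [Q'] comaximal with [P], itself inside [Q'], so [Q']
   would contain [1]. *)
have [h [p [Hh Pp hp]]] := simple_factor_comaximal simP (idealP Q') Q'r nPr.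
apply: Q'1; rewrite hp; apply: idealD => //.
by apply: PQ; exists p.
Qed.
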